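(* Let $\mathcal{A}$ be a Banach algebra. The following conditions are equivalent: (i) $\mathcal{A}$ is approximately amenable; (ii) for any Banach $\mathcal{A}$-bimodule $\mathcal{X}$, every bounded derivation $D:\mathcal{A}\to\mathcal{X}^{**}$ is approximately inner.
   Context: The dual $\mathcal{X}^*$ of a Banach $\mathcal{A}$-bimodule $\mathcal{X}$ is a Banach $\mathcal{A}$-bimodule via $\langle x, a\cdot\Lambda\rangle=\langle x\cdot a,\Lambda\rangle$ and $\langle x,\Lambda\cdot a\rangle=\langle a\cdot x,\Lambda\rangle$. $\mathcal{X}^{**}$ is the dual bimodule of $\mathcal{X}^*$. A derivation $D:\mathcal{A}\to\mathcal{X}$ is a linear map with $D(ab)=a\cdot D(b)+D(a)\cdot b$. It is approximately inner if there is a net $(x_\alpha)\subseteq\mathcal{X}$ (not required to be bounded) with $D(a)=\lim_\alpha(a\cdot x_\alpha-x_\alpha\cdot a)$ in norm for every $a\in\mathcal{A}$. $\mathcal{A}$ is approximately amenable if for each Banach $\mathcal{A}$-bimodule $\mathcal{X}$ every bounded derivation $D:\mathcal{A}\to\mathcal{X}^*$ is approximately inner. *)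

(* Defs.v *)
From HB Require Import structures.
From mathcomp Require Import all_boot all_order all_algebra complex.
From mathcomp Require Import boolp classical_sets functions reals topology.
From mathcomp Require Import normedtype.

Set Implicit Arguments.
Unset Strict Implicit.
Unset Printing Implicit Defensive.

Import Order.TTheory GRing.Theory Num.Theory.
Import numFieldNormedType.Exports.

Local Open Scope classical_set_scope.
Local Open Scope ring_scope.

(* Ring structures are unital, whereas a Banach algebra need not have a unit:
   the product is therefore a separate operation [amul]. *)
HB.mixin Record CompleteNormedModule_isBanachAlgebra (K : numFieldType) A
    & CompleteNormedModule K A := {
  amul : A -> A -> A ;
  amulA : associative amul ;
  amul_linearr : forall a, linear (amul a) ;
  amul_linearl : forall b, linear (amul^~ b) ;
  ler_norm_amul : forall a b, `|amul a b| <= `|a| * `|b|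
}.

#[short(type="banachAlgType")]
HB.structure Definition BanachAlgebra (K : numFieldType) :=
  {A of CompleteNormedModule K A & CompleteNormedModule_isBanachAlgebra K A}.

(* [lact a x] is a . x and [ract x a] is x . a *)
HB.mixin Record CompleteNormedModule_isBanachBimodule (K : numFieldType)
    (A : banachAlgType K) X & CompleteNormedModule K X := {
  lact : A -> X -> X ;
  ract : X -> A -> X ;
  lact_linearr : forall a, linear (lact a) ;
  lact_linearl : forall x, linear (lact^~ x) ;
  ract_linearl : forall a, linear (ract^~ a) ;
  ract_linearr : forall x, linear (ract x) ;
  lactM : forall a b x, lact (amul a b) x = lact a (lact b x) ;
  ractM : forall x a b, ract x (amul a b) = ract (ract x a) b ;
  lractA : forall a x b, ract (lact a x) b = lact a (ract x b) ;
  lact_bounded : exists M, forall a x, `|lact a x| <= M * (`|a| * `|x|) ;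
  ract_bounded : exists M, forall x a, `|ract x a| <= M * (`|x| * `|a|)
}.

#[short(type="banachBimodType")]
HB.structure Definition BanachBimodule (K : numFieldType)
    (A : banachAlgType K) :=
  {X of CompleteNormedModule K X
      & CompleteNormedModule_isBanachBimodule K A X}.

Section bounded.
Variable K : numFieldType.

Lemma le_norm_bound (u v M : K) : 0 <= u -> 0 <= v -> u <= M * v ->
  u <= `|M| * v.
Proof.
move=> u0 v0 uM; rewrite -(ger0_norm v0) -normrM ger0_norm//.
exact: le_trans uM.
Qed.

Lemma le_mul_bound (M a f x y : K) : 0 <= f -> y <= M * a * x ->
  f * y <= M * (a * f) * x.
Proof. by move=> f0 yM; rewrite mulrA mulrAC mulrC ler_wpM2r// mulrC. Qed.

Lemma bounded_linear_fun_continuous (V W : normedModType K) (f : V -> W) M :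
  linear f -> (forall x, `|f x| <= M * `|x|) -> continuous f.
Proof.
move=> fl fM.
pose L : {linear V -> W} := HB.pack f (GRing.isLinear.Build _ _ _ _ _ fl).
apply: (@bounded_linear_continuous _ _ _ L); apply/linear_boundedP.
exists `|M|; split=> [|r Mr x]; first exact: normr_real.
rewrite (@le_trans _ _ (`|M| * `|x|))//; first exact: le_norm_bound.
by rewrite ler_wpM2r// ltW.
Qed.

End bounded.

Section complete_complex.
Variable R : realType.
Local Notation C := R[i].

Let ReB (x y : C) : complex.Re (x - y) = complex.Re x - complex.Re y.
Proof. by case: x y => [? ?] [? ?]. Qed.

Let ImB (x y : C) : complex.Im (x - y) = complex.Im x - complex.Im y.
Proof. by case: x y => [? ?] [? ?]. Qed.

Let lt_norm_Re (x : C) e : `|x| < e%:C%C -> `|complex.Re x| < e.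
Proof. by move=> /(le_lt_trans (normc_ge_Re x)); rewrite ltcR. Qed.

Let lt_norm_Im (x : C) e : `|x| < e%:C%C -> `|complex.Im x| < e.
Proof.
case: x => a b; rewrite normc_def ltcR; apply: le_lt_trans.
by rewrite /= -sqrtr_sqr ler_wsqrtr// lerDr sqr_ge0.
Qed.

Let norm_lt (x : C) e : `|complex.Re x| < e / 2 -> `|complex.Im x| < e / 2 ->
  `|x| < e%:C%C.
Proof.
move=> xe ye; have -> : x = (complex.Re x)%:C%C + 'i%C * (complex.Im x)%:C%C.
  exact: complexE.
rewrite (le_lt_trans (ler_normD _ _))// normrM.
rewrite !normc_def/= !expr0n/= !expr1n add0r sqrtr1 mul1r !addr0 !sqrtr_sqr.
by rewrite -rmorphD ltcR (splitr e) ltrD.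
Qed.

Let posC (e : C) : 0 < e -> exists2 r, 0 < r & e = r%:C%C.
Proof.
by case: e => a b; rewrite ltcE/= => /andP[/eqP -> a0]; exists a.
Qed.

Lemma complex_complete (F : set_system C^o) :
  ProperFilter F -> cauchy F -> cvg F.
Proof.
move=> FF /cauchyP Fc.
have part (h : C -> R) : (forall x y : C, h (x - y) = h x - h y) ->
    (forall (x : C) e, `|x| < e%:C%C -> `|h x| < e) ->
    exists l : R, h @ F --> l.
  move=> hB hlt; apply/cvg_ex; apply: R_complete.
  apply: cauchy_exP => e e0.
  have [|x Fx] := Fc e%:C%C; first by rewrite ltcR.
  exists (h x); rewrite /fmap/=; apply: filterS Fx => y.
  by rewrite -!ball_normE/= => /hlt; rewrite hB.
have [a Fa] := part _ ReB lt_norm_Re.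
have [b Fb] := part _ ImB lt_norm_Im.
apply/cvg_ex; exists (Complex a b : C^o).
apply/cvgrPdist_lt => _ /posC[e e0 ->].
have e20 : 0 < e / 2 by rewrite divr_gt0.
move/cvgrPdist_lt : Fa => /(_ _ e20) Fa.
move/cvgrPdist_lt : Fb => /(_ _ e20) Fb.
near=> z; apply: norm_lt; rewrite ?ReB ?ImB/=; first by near: z.
by near: z.
Unshelve. all: by end_near. Qed.

End complete_complex.

HB.instance Definition _ (R : realType) :=
  Uniform_isComplete.Build R[i]^o (@complex_complete R).

Section dual.
Variables (R : realType) (X : normedModType R[i]).
Local Notation C := R[i].

Definition continuous_functional : {pred X -> C^o} :=
  mem [set f : X -> C^o | linear f /\ continuous f].

Lemma continuous_functionalP f :
  f \in continuous_functional <-> linear f /\ continuous f.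
Proof. by split=> [/set_mem|fP]; last exact/mem_set. Qed.

Record dual := Dual {
  dual_fun :> X -> C^o ;
  dual_funP : dual_fun \in continuous_functional }.

HB.instance Definition _ := [isSub for dual_fun].
HB.instance Definition _ := [Choice of dual by <:].

Let continuous_functional_submod : submod_closed continuous_functional.
Proof.
split=> [|k f g].
  apply/continuous_functionalP; split=> [a x y|]; last exact: cst_continuous.
  by rewrite /= scaler0 addr0.
move=> /continuous_functionalP[fl fc] /continuous_functionalP[gl gc].
apply/continuous_functionalP; split=> [a x y|x].
  change (k *: f (a *: x + y) + g (a *: x + y) =
    a *: (k *: f x + g x) + (k *: f y + g y)).
  by rewrite fl gl !scalerDr !scalerA (mulrC k) addrACA.
by apply: cvgD; [apply: cvgZr; exact: fc|exact: gc].
Qed.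

HB.instance Definition _ :=
  GRing.isSubmodClosed.Build C _ continuous_functional
    continuous_functional_submod.
HB.instance Definition _ := [SubChoice_isSubLmodule of dual by <:].

Implicit Types f g : dual.

Lemma dual_linear f : linear f.
Proof. by have /continuous_functionalP[] := dual_funP f. Qed.

Lemma dual_continuous f : continuous f.
Proof. by have /continuous_functionalP[] := dual_funP f. Qed.

HB.instance Definition _ f :=
  GRing.isLinear.Build C X C^o _ f (@dual_linear f).

Lemma dual_ext f g : f =1 g -> f = g.
Proof. by move=> fg; apply/val_inj/funext. Qed.

Lemma dualDE f g x : (f + g) x = f x + g x.
Proof. by []. Qed.

Lemma dualZE (k : C) f x : (k *: f) x = k *: f x.
Proof. by []. Qed.

Lemma dualNE f x : (- f) x = - f x.
Proof. by []. Qed.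

Lemma dual_bounded f : exists2 M : R, 0 <= M &
  forall x, `|f x| <= M%:C%C * `|x|.
Proof.
have /linear_bounded_continuous/linear_boundedP := @dual_continuous f.
move=> /pinfty_ex_gt0 [M M0 fM].
have M0' : M = (complex.Re M)%:C%C by rewrite RRe_real// gtr0_real.
exists (complex.Re M); last by rewrite -M0'.
by rewrite -lecR -M0' ltW.
Qed.

(* Norms over [R[i]] take values in [R[i]]: the operator norm is a supremum
   of real numbers embedded in [R[i]]. *)
Definition dual_norm f : C :=
  (sup [set complex.Re `|f x| | x in [set x | `|x| <= 1]])%:C%C.

Let normRe (z : C) : `|z| = (complex.Re `|z|)%:C%C.
Proof. by rewrite RRe_real ?normr_real. Qed.

Let dual_norm_ubound f :
  has_ubound [set complex.Re `|f x| | x in [set x | `|x| <= 1]].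
Proof.
have [M M0 fM] := dual_bounded f.
exists M => _ [x /= x1 <-]; rewrite -lecR -normRe (le_trans (fM x))//.
by rewrite ler_piMr// lecR.
Qed.

Lemma ler_dual_norm f x : `|f x| <= dual_norm f * `|x|.
Proof.
have [->|x0] := eqVneq x 0; first by rewrite linear0 !normr0 mulr0.
have nx0 : 0 < `|x| by rewrite normr_gt0.
rewrite -ler_pdivrMr// mulrC -[X in X * _]ger0_norm ?invr_ge0//.
rewrite -normrZ -linearZ/= normRe lecR; apply: ub_le_sup => //.
by exists (`|x|^-1 *: x) => //=; rewrite normrZ normfV normr_id mulVf ?gt_eqF.
Qed.

Lemma dual_norm_ge0 f : 0 <= dual_norm f.
Proof.
rewrite lecR; apply: ub_le_sup => //.
exists 0; first by rewrite /= normr0 ler01.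
by apply: complexI; rewrite -normRe linear0 normr0.
Qed.

Lemma dual_norm_le f (M : C) : 0 <= M -> (forall x, `|f x| <= M * `|x|) ->
  dual_norm f <= M.
Proof.
move=> M0 fM; rewrite -(RRe_real (ger0_real M0)) lecR; apply: ge_sup.
  by exists (complex.Re `|f 0|), 0 => //=; rewrite normr0 ler01.
move=> _ [x /= x1 <-]; rewrite -lecR -normRe (RRe_real (ger0_real M0)).
by rewrite (le_trans (fM x))// ler_piMr.
Qed.

Let dual_normD f g : dual_norm (f + g) <= dual_norm f + dual_norm g.
Proof.
apply: dual_norm_le => [|x]; first by rewrite addr_ge0 ?dual_norm_ge0.
by rewrite mulrDl (le_trans (ler_normD _ _))// lerD ?ler_dual_norm.
Qed.

Let dual_normZ_le (k : C) f : dual_norm (k *: f) <= `|k| * dual_norm f.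
Proof.
apply: dual_norm_le => [|x]; first by rewrite mulr_ge0 ?dual_norm_ge0.
by rewrite dualZE normrZ -mulrA ler_wpM2l// ler_dual_norm.
Qed.

Let dual_normZ (k : C) f : dual_norm (k *: f) = `|k| * dual_norm f.
Proof.
apply/eqP; rewrite eq_le dual_normZ_le/=.
have [->|k0] := eqVneq k 0; first by rewrite normr0 mul0r dual_norm_ge0.
rewrite mulrC -ler_pdivlMr ?normr_gt0// mulrC -normfV.
by rewrite (le_trans _ (dual_normZ_le _ _))// scalerA mulVf// scale1r.
Qed.

Let dual_norm0_eq0 f : dual_norm f = 0 -> f = 0.
Proof.
move=> f0; apply: dual_ext => x; apply/eqP.
by rewrite -normr_le0 (le_trans (ler_dual_norm f x))// f0 mul0r.
Qed.

HB.instance Definition _ :=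
  @Lmodule_isNormed.Build C dual dual_norm dual_normD dual_normZ dual_norm0_eq0.

Lemma dual_normE f : `|f| = dual_norm f.
Proof. by []. Qed.

Lemma dual_complete (F : set_system dual) : ProperFilter F -> cauchy F -> cvg F.
Proof.
move=> FF Fc.
have Fc2 (e : C) : 0 < e -> exists2 A, F A &
    forall f g, A f -> A g -> forall x, `|f x - g x| <= e * `|x|.
  move=> e0; have e20 : 0 < e / 2 by rewrite divr_gt0.
  have /cauchyP/(_ _ e20)[h Fh] := Fc.
  exists (ball h (e / 2)) => // f g hf hg x.
  have fg : `|f - g| <= e.
    move: hf hg; rewrite -!ball_normE/= => hf hg.
    rewrite -(subrKA h) (le_trans (ler_normD _ _))// distrC [leRHS]splitr.
    by rewrite lerD// ltW.
  by rewrite (le_trans (ler_dual_norm (f - g) x))// ler_wpM2r.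
have ev x : exists l : C^o, (fun f : dual => f x) @ F --> l.
  apply/cvg_ex; apply: complex_complete; apply: cauchy_exP => e e0.
  have d0 : 0 < e / (`|x| + 1) by rewrite divr_gt0// ltr_wpDl.
  have [A FA Ae] := Fc2 _ d0; have [h Ah] := filter_ex FA.
  exists (h x); rewrite /fmap/=; apply: filterS FA => f Af.
  rewrite -ball_normE/=.
  rewrite (le_lt_trans (Ae _ _ Ah Af x))// mulrAC -mulrA gtr_pMr//.
  by rewrite ltr_pdivrMr ?mul1r ?ltrDl// ltr_wpDl.
have [l Fl] := choice ev.
have close (e : C) : 0 < e -> exists2 A, F A &
    forall f, A f -> forall x, `|f x - l x| <= e * `|x|.
  move=> e0; have [A FA Ae] := Fc2 _ e0; exists A => // f Af x.
  apply/ler_addgt0Pr => d d0.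
  move/cvgrPdist_lt : (Fl x) => /(_ _ d0) Fd.
  have [g [Ag /= gd]] := filter_ex (filterI FA Fd).
  rewrite -(subrKA (g x)) (le_trans (ler_normD _ _))// lerD//; first exact: Ae.
  by rewrite distrC ltW.
have llin : linear l.
  move=> k x y.
  have Fxy : (fun f : dual => k *: f x + f y : C^o) @ F --> k *: l x + l y.
    by apply: cvgD; [apply: cvgZr; exact: Fl|exact: Fl].
  apply: (norm_cvg_unique (Fl _)); apply: cvg_trans Fxy.
  by apply: near_eq_cvg; apply: nearW => f; rewrite linearP.
have lcont : continuous l.
  have [A FA Ae] := close _ ltr01; have [h Ah] := filter_ex FA.
  have [M M0 hM] := dual_bounded h.
  apply: (@bounded_linear_fun_continuous _ _ _ l (M%:C%C + 1)) => // x.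
  have -> : l x = (l x - h x) + h x by rewrite subrK.
  rewrite (le_trans (ler_normD _ _))// [leRHS]mulrDl [leRHS]addrC lerD//.
  by rewrite distrC Ae.
have lP : l \in continuous_functional by exact/continuous_functionalP.
apply/cvg_ex; exists (Dual lP); apply/cvgrPdist_le => e e0.
have [A FA Ae] := close _ e0; apply: filterS FA => f Af.
rewrite dual_normE; apply: dual_norm_le => [|x]; first exact: ltW.
by rewrite dualDE dualNE/= distrC Ae.
Qed.

HB.instance Definition _ := Uniform_isComplete.Build dual dual_complete.

End dual.

Section dual_bimodule.
Variables (R : realType) (A : banachAlgType R[i]) (X : banachBimodType A).
Local Notation C := R[i].
Implicit Types (a b : A) (x y : X) (f g : dual X).

Let lact_le : exists2 M : C, 0 <= M &
  forall a x, `|lact a x| <= M * `|a| * `|x|.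
Proof.
have [M aM] := @lact_bounded C A X; exists `|M| => // a x.
by rewrite -mulrA; apply: le_norm_bound => //; rewrite mulr_ge0.
Qed.

Let ract_le : exists2 M : C, 0 <= M &
  forall x a, `|ract x a| <= M * `|a| * `|x|.
Proof.
have [M aM] := @ract_bounded C A X; exists `|M| => // x a.
by rewrite -mulrA (mulrC `|a|); apply: le_norm_bound => //; rewrite mulr_ge0.
Qed.

Let dual_lact_subproof a f :
  (fun x => f (ract x a)) \in @continuous_functional R X.
Proof.
apply/continuous_functionalP; split=> [k x y|x].
  by rewrite ract_linearl linearP.
apply: (@continuous_comp _ _ _ (fun x => ract x a) f x);
  last exact: dual_continuous.
have [M _ aM] := ract_le.
exact: (bounded_linear_fun_continuous (ract_linearl a) (aM^~ a)).
Qed.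

Let dual_ract_subproof f a :
  (fun x => f (lact a x)) \in @continuous_functional R X.
Proof.
apply/continuous_functionalP; split=> [k x y|x].
  by rewrite lact_linearr linearP.
apply: (@continuous_comp _ _ _ (fun x => lact a x) f x);
  last exact: dual_continuous.
have [M _ aM] := lact_le.
exact: (bounded_linear_fun_continuous (lact_linearr a) (aM a)).
Qed.

Definition dual_lact a f : dual X := Dual (dual_lact_subproof a f).

Definition dual_ract f a : dual X := Dual (dual_ract_subproof f a).

Let dual_lact_linearr a : linear (dual_lact a).
Proof. by move=> k f g; exact: dual_ext. Qed.

Let dual_lact_linearl f : linear (dual_lact^~ f).
Proof.
by move=> k a b; apply: dual_ext => x /=; rewrite ract_linearr linearP.
Qed.

Let dual_ract_linearl a : linear (dual_ract^~ a).
Proof. by move=> k f g; exact: dual_ext. Qed.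

Let dual_ract_linearr f : linear (dual_ract f).
Proof.
by move=> k a b; apply: dual_ext => x /=; rewrite lact_linearl linearP.
Qed.

Let dual_lactM a b f : dual_lact (amul a b) f = dual_lact a (dual_lact b f).
Proof. by apply: dual_ext => x /=; rewrite ractM. Qed.

Let dual_ractM f a b : dual_ract f (amul a b) = dual_ract (dual_ract f a) b.
Proof. by apply: dual_ext => x /=; rewrite lactM. Qed.

Let dual_lractA a f b :
  dual_ract (dual_lact a f) b = dual_lact a (dual_ract f b).
Proof. by apply: dual_ext => x /=; rewrite lractA. Qed.

Let dual_lact_bounded :
  exists M, forall a f, `|dual_lact a f| <= M * (`|a| * `|f|).
Proof.
have [M M0 aM] := ract_le; exists M => a f.
apply: dual_norm_le => [|x]; first by rewrite !mulr_ge0.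
rewrite (le_trans (ler_dual_norm f _))//.
exact: le_mul_bound (dual_norm_ge0 f) (aM _ _).
Qed.

Let dual_ract_bounded :
  exists M, forall f a, `|dual_ract f a| <= M * (`|f| * `|a|).
Proof.
have [M M0 aM] := lact_le; exists M => f a.
apply: dual_norm_le => [|x]; first by rewrite !mulr_ge0.
rewrite (le_trans (ler_dual_norm f _))//.
rewrite [`|f| * `|a|]mulrC.
exact: le_mul_bound (dual_norm_ge0 f) (aM _ _).
Qed.

HB.instance Definition _ :=
  CompleteNormedModule_isBanachBimodule.Build C A (dual X)
    dual_lact_linearr dual_lact_linearl dual_ract_linearl dual_ract_linearr
    dual_lactM dual_ractM dual_lractA dual_lact_bounded dual_ract_bounded.

Lemma dual_lactE a f x : (lact a f : dual X) x = f (ract x a).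
Proof. by []. Qed.

Lemma dual_ractE f a x : (ract f a : dual X) x = f (lact a x).
Proof. by []. Qed.

End dual_bimodule.

Section approximate_amenability.
Variables (K : numFieldType) (A : banachAlgType K) (X : banachBimodType A).

Definition derivation (D : A -> X) : Prop :=
  linear D /\ forall a b, D (amul a b) = lact a (D b) + ract (D a) b.

Definition bounded_map (D : A -> X) : Prop :=
  exists M, forall a, `|D a| <= M * `|a|.

Definition directed (I : Type) (le : I -> I -> Prop) : Prop :=
  [/\ inhabited I, forall i, le i i,
      forall i j k, le i j -> le j k -> le i k &
      forall i j, exists k, le i k /\ le j k].

(* The filter of tails: convergence along it is convergence of nets. *)
Definition tails (I : Type) (le : I -> I -> Prop) : set_system I :=
  filter_from [set: I] (fun i => [set j | le i j]).

Definition approximately_inner (D : A -> X) : Prop :=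
  exists (I : Type) (le : I -> I -> Prop) (x : I -> X), directed le /\
    forall a, (fun i => lact a (x i) - ract (x i) a) @ tails le --> D a.

End approximate_amenability.

Definition approximately_amenable (R : realType) (A : banachAlgType R[i]) :=
  forall (X : banachBimodType A) (D : A -> dual X),
    derivation D -> bounded_map D -> approximately_inner D.

(* Main.v *)
(* (i) applied to the bimodule [X^*] is (ii) for [X].  Conversely, given
   [D : A -> X^*], compose it with the canonical embedding [J : X^* -> X^***],
   which is a bounded bimodule map, and apply (ii).  The transpose
   [P : X^*** -> X^*] of the canonical embedding [X -> X^**] is a bounded
   bimodule map with [P \o J = id], so it carries a net implementing [J \o D]
   to a net implementing [D]. *)
Require Import Defs.
From mathcomp Require Import all_boot all_order all_algebra complex.
From mathcomp Require Import boolp classical_sets reals topology normedtype.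

Set Implicit Arguments.
Unset Strict Implicit.
Unset Printing Implicit Defensive.

Import Order.TTheory GRing.Theory Num.Theory.
Import numFieldNormedType.Exports.

Local Open Scope classical_set_scope.
Local Open Scope ring_scope.

Section bimodule_maps.
Variables (K : numFieldType) (A : banachAlgType K) (X Y : banachBimodType A).

Definition bimodule_map (T : X -> Y) : Prop :=
  [/\ linear T, forall a x, T (lact a x) = lact a (T x) &
      forall x a, T (ract x a) = ract (T x) a].

Lemma derivation_comp (T : X -> Y) (D : A -> X) :
  bimodule_map T -> derivation D -> derivation (T \o D).
Proof.
move=> [Tl Tlact Tract] [Dl DM]; split=> [k a b|a b] /=.
  by rewrite Dl Tl.
(* [linear] speaks of [k *: u + v], so additivity of [T] is its case [k = 1]. *)
by rewrite DM -[X in X + _]scale1r Tl scale1r Tlact Tract.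
Qed.

(** [T] sends [a.x_i - x_i.a] to [a.(T x_i) - (T x_i).a], so the image net, over the same index set,
    implements [T \o D] once continuity carries the limit through [T]. *)
Lemma approximately_inner_comp (T : X -> Y) (D : A -> X) :
  bimodule_map T -> continuous T ->
  approximately_inner D -> approximately_inner (T \o D).
Proof.
move=> [Tl Tlact Tract] Tc [I [le [x [le_dir xD]]]].
exists I, le, (T \o x); split=> // a.
have -> : (fun i => lact a ((T \o x) i) - ract ((T \o x) i) a) =
          T \o (fun i => lact a (x i) - ract (x i) a).
  apply/funext => i /=.
  by rewrite addrC -scaleN1r -Tlact -Tract -Tl scaleN1r addrC.
apply: cvg_comp; [exact: xD|exact: Tc].
Qed.

End bimodule_maps.

Section canonical_embedding.
Variables (R : realType) (X : normedModType R[i]).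

Let eval_subproof (x : X) :
  (fun f : dual X => f x) \in @continuous_functional R (dual X).
Proof.
have xl : linear (fun f : dual X => f x : R[i]^o) by [].
apply/continuous_functionalP; split=> //.
apply: (bounded_linear_fun_continuous (M := `|x|) xl) => f.
by rewrite mulrC ler_dual_norm.
Qed.

Definition bidual_embed (x : X) : dual (dual X) := Dual (eval_subproof x).

Lemma bidual_embed_linear : linear bidual_embed.
Proof. by move=> k x y; apply: dual_ext => f /=; rewrite linearP. Qed.

Lemma bidual_embed_le (x : X) : `|bidual_embed x| <= `|x|.
Proof.
by apply: dual_norm_le => // f; rewrite mulrC; exact: ler_dual_norm.
Qed.

Lemma bidual_embed_continuous : continuous bidual_embed.
Proof.
apply: (bounded_linear_fun_continuous (M := 1) bidual_embed_linear) => x.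
by rewrite mul1r bidual_embed_le.
Qed.

Let restrict_subproof (F : dual (dual (dual X))) :
  (fun x => F (bidual_embed x)) \in @continuous_functional R X.
Proof.
apply/continuous_functionalP; split=> [k x y|x].
  by rewrite bidual_embed_linear linearP.
apply: (@continuous_comp _ _ _ bidual_embed F x).
  exact: bidual_embed_continuous.
exact: dual_continuous.
Qed.

(** After identifying [X^*] with its image in [X^***], this is the Dixmier projection. *)
Definition bidual_restrict (F : dual (dual (dual X))) : dual X :=
  Dual (restrict_subproof F).

Lemma bidual_restrict_linear : linear bidual_restrict.
Proof. by move=> k F G; exact: dual_ext. Qed.

Lemma bidual_restrict_continuous : continuous bidual_restrict.
Proof.
apply: (bounded_linear_fun_continuous (M := 1) bidual_restrict_linear) => F.
rewrite mul1r; apply: dual_norm_le => [|x]; first exact: normr_ge0.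
rewrite (le_trans (ler_dual_norm F _))// ler_wpM2l ?dual_norm_ge0//.
exact: bidual_embed_le.
Qed.

End canonical_embedding.

Lemma bidual_embedK (R : realType) (X : normedModType R[i]) :
  cancel (@bidual_embed R (dual X)) (@bidual_restrict R X).
Proof. by move=> f; exact: dual_ext. Qed.

Section canonical_bimodule_maps.
Variables (R : realType) (A : banachAlgType R[i]) (X : banachBimodType A).

(** Dualizing swaps the two sides, so dualizing twice restores them: at [f], both [J(a.x)] and
    [a.(J x)] evaluate to [f(a.x)], and likewise on the right. *)
Lemma bidual_embed_bimodule :
  bimodule_map (@bidual_embed R X : X -> dual (dual X)).
Proof.
by split=> [|a x|x a]; [exact: bidual_embed_linear|exact: dual_ext..].
Qed.

Lemma bidual_restrict_bimodule :
  bimodule_map (@bidual_restrict R X : dual (dual (dual X)) -> dual X).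
Proof.
have [_ Jlact Jract] := bidual_embed_bimodule.
split=> [|a F|F a]; first exact: bidual_restrict_linear.
(* The left action on a dual is the transpose of the right action, hence [Jract] here and [Jlact]
   for the other side. *)
- by apply: dual_ext => x /=; rewrite Jract.
- by apply: dual_ext => x /=; rewrite Jlact.
Qed.

End canonical_bimodule_maps.

Theorem proposition2p3 (R : realType) (A : banachAlgType R[i]) :
  approximately_amenable A <->
  (forall (X : banachBimodType A) (D : A -> dual (dual X)),
     derivation D -> bounded_map D -> approximately_inner D).
Proof.
split=> [amen X D|amen X D Dder [M DM]]; first exact: (amen (dual X)).
have JD : approximately_inner (@bidual_embed R (dual X) \o D).
  apply: amen; first exact: (derivation_comp (bidual_embed_bimodule _)).
  (* The embedding is contractive, so the bound of [D] also serves for the composite. *)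
  by exists M => a; exact: le_trans (bidual_embed_le _) (DM a).
have -> : D = @bidual_restrict R X \o (@bidual_embed R (dual X) \o D).
  by apply/funext => a /=; rewrite bidual_embedK.
apply: approximately_inner_comp JD; first exact: bidual_restrict_bimodule.
exact: bidual_restrict_continuous.
Qed.
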